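(* Consider the centralized caching problem with uncoded prefetching with $K$ users, $N$ files, and local cache size of $M$ files at each user, and let $t=\frac{KM}{N}$. Then for $t\in\{0,1,\dots,K\}$, $$R^*=\mathbb{E}_{\boldsymbol{d}}\left[\frac{\binom{K}{t+1}-\binom{K-N_{\mathrm{e}}(\boldsymbol{d})}{t+1}}{\binom{K}{t}}\right],$$ where $\boldsymbol{d}$ is uniformly random on $\{1,\dots,N\}^K$. Furthermore, for $t\notin\{0,1,\dots,K\}$ (i.e. $t\in[0,K]$ non-integer), $R^*$ (viewed as a function of $t$) equals the lower convex envelope of its values at $t\in\{0,1,\dots,K\}$.
   Context: Setting: a server holds $N$ files $W_1,\dots,W_N$, each of $F$ bits; the $j$-th bit of file $i$ is $B_{i,j}$, and all $NF$ bits are i.i.d. Bernoulli$(1/2)$. There are $K$ users, each with a cache of $MF$ bits, $M\in[0,N]$; set $t=KM/N$. An uncoded prefetching is $\boldsymbol{\mathcal{M}}=(\mathcal{M}_1,\dots,\mathcal{M}_K)$ where each $\mathcal{M}_k$ is a set of at most $MF$ bit indices $(i,j)$, and user $k$ stores the bits $\{B_{i,j}:(i,j)\in\mathcal{M}_k\}$. A demand is $\boldsymbol{d}=(d_1,\dots,d_K)\in\{1,\dots,N\}^K$ (user $k$ requests $W_{d_k}$); $N_{\mathrm{e}}(\boldsymbol{d})$ is the number of distinct entries of $\boldsymbol{d}$. Given $\boldsymbol{\mathcal{M}}$ and $\boldsymbol{d}$, a rate $R$ is $\epsilon$-achievable if there exist an encoding function $\psi:\{0,1\}^{NF}\to\{0,1\}^{RF}$,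 $X=\psi(W_1,\dots,W_N)$, and decoding functions $\mu_k:\{0,1\}^{RF}\times\{0,1\}^{|\mathcal{M}_k|}\to\{0,1\}^F$ giving $\hat W_{\boldsymbol{d},k}=\mu_k(X,\{B_{i,j}:(i,j)\in\mathcal{M}_k\})$ with $\mathbb{P}(\hat W_{\boldsymbol{d},k}\neq W_{d_k})\le\epsilon$ for every $k$. $R^*_\epsilon(\boldsymbol{d},\boldsymbol{\mathcal{M}})$ is the minimum $\epsilon$-achievable rate; $R^*_\epsilon(\boldsymbol{\mathcal{M}})=\mathbb{E}_{\boldsymbol{d}}[R^*_\epsilon(\boldsymbol{d},\boldsymbol{\mathcal{M}})]$ with $\boldsymbol{d}$ uniform on $\{1,\dots,N\}^K$; and $R^*=\sup_{\epsilon>0}\limsup_{F\to\infty}\min_{\boldsymbol{\mathcal{M}}}R^*_\epsilon(\boldsymbol{\mathcal{M}})$, the minimum over all uncoded prefetchings satisfying the memory constraint. Convention: $\binom{n}{k}=0$ when $k>n$. *)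

(* Defs.v *)
From HB Require Import structures.
From mathcomp Require Import all_boot all_order all_algebra.
From mathcomp Require Import all_classical all_reals all_analysis.
Set Implicit Arguments. Unset Strict Implicit. Unset Printing Implicit Defensive.
Import Order.TTheory GRing.Theory Num.Theory.
Local Open Scope classical_set_scope.
Local Open Scope ring_scope.

Section Caching.
Variable R : realType.
Variables (N K F : nat).

Definition bitidx := ('I_N * 'I_F)%type.
Definition library := {ffun bitidx -> bool}.
Definition file := {ffun 'I_F -> bool}.
Definition message (L : nat) := {ffun 'I_L -> bool}.
Definition demand := {ffun 'I_K -> 'I_N}.
(* an uncoded prefetching: user k stores the bits indexed by P k *)
Definition prefetching := {ffun 'I_K -> {set bitidx}}.

Definition valid_prefetching (M : R) (P : prefetching) : Prop :=
  forall k, (#|P k|%:R <= M * F%:R).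

Definition file_of (w : library) (i : 'I_N) : file := [ffun j => w (i, j)].

(* the cache content {B_{i,j} : (i,j) in S}, encoded as the library with
   all bits outside S erased (S is known to the decoder) *)
Definition cache_content (S : {set bitidx}) (w : library) : library :=
  [ffun b => (b \in S) && w b].

(* P(W_hat_{d,k} <> W_{d_k}) with all N F bits i.i.d. Bernoulli(1/2) *)
Definition err_prob (L : nat) (psi : library -> message L)
  (mu : message L -> library -> file) (S : {set bitidx}) (i : 'I_N) : R :=
  #|[set w : library | mu (psi w) (cache_content S w) != file_of w i]|%:R
  / (2 ^ (N * F))%:R.

Definition achievable_len (eps : R) (d : demand) (P : prefetching) (L : nat)
  : Prop :=
  exists (psi : library -> message L)
         (mu : 'I_K -> message L -> library -> file),
    forall k : 'I_K, err_prob psi (mu k) (P k) (d k) <= eps.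

Definition Rstar_eps_d (eps : R) (d : demand) (P : prefetching) : R :=
  inf [set (L%:R / F%:R : R) | L in [set L | achievable_len eps d P L]].

Definition Rstar_eps (eps : R) (P : prefetching) : R :=
  (\sum_(d : demand) Rstar_eps_d eps d P) / (N ^ K)%:R.

Definition Rstar_eps_min (eps : R) (M : R) : R :=
  inf [set Rstar_eps eps P | P in [set P | valid_prefetching M P]].

End Caching.

Definition Rstar (R : realType) (N K : nat) (M : R) : R :=
  sup [set limn_sup (fun F : nat => @Rstar_eps_min R N K F eps M)
      | eps in [set eps : R | 0 < eps]].

Definition Ne (N K : nat) (d : {ffun 'I_K -> 'I_N}) : nat :=
  #|[set d k | k : 'I_K]%SET|.

Definition Rformula (R : realType) (N K t : nat) : R :=
  (\sum_(d : {ffun 'I_K -> 'I_N})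
     (('C(K, t.+1))%:R - ('C(K - Ne d, t.+1))%:R) / ('C(K, t))%:R)
  / (N ^ K)%:R.

Definition lower_convex_envelope (R : realType) (K : nat) (f : nat -> R)
  (t : R) : R :=
  inf [set \sum_(i < K.+1) lam i * f i |
        lam in [set lam : 'I_K.+1 -> R |
                 [/\ forall i, 0 <= lam i,
                     \sum_(i < K.+1) lam i = 1 &
                     \sum_(i < K.+1) lam i * (i : nat)%:R = t]]].

(* Main.v *)
(** Converse.  If every user errs with probability at most 1/(2(K+1)), at least
    half of the libraries are decoded correctly by all users.  Let u_1, ..., u_m
    be users with distinct demands.  A correctly decoded library is determined by
    the message together with the bits which are not unknown, where a bit of
    the file demanded by u_i is unknown when none of u_1, ..., u_i caches it: one
    recovers the demanded files one after the other.  Hence there are at most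
    L + 1 unknown bits.  Averaging over all relabellings of users and files, a
    bit cached by n users contributes r(n) = Rformula n to the rate.  Since
    r(n) is a positive combination of the functions binom(K - n, i), it is
    convex and nonincreasing in n, and the memory constraint bounds the average
    of n by t.

    Achievability.  Bits of each file are spread over the subsets S of users
    that cache them, with weight lam_n on the subsets of size n (memory
    sharing).  For every set A of users, the xor over k in A of the part of
    user k's file cached by A \ k is a useful signal; only the signals of sets
    A meeting a fixed set of leaders (one per demanded file) are sent, since the
    other ones are linear combinations of these.  The rate is then
    sum_n lam_n r(n) + O(1/F). *)
Require Import Defs.
From HB Require Import structures.
From mathcomp Require Import all_boot all_order all_algebra all_fingroup.
From mathcomp Require Import all_classical all_reals all_analysis.
From mathcomp Require Import zify ring lra.
Set Implicit Arguments. Unset Strict Implicit. Unset Printing Implicit Defensive.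
Import Order.TTheory GRing.Theory Num.Theory.

(** * Coded delivery *)

(** Within each orbit of [h], [enum_rank] selects one of the two points; reindexing by [h] turns one
    half of the sum into the other, and equal terms cancel. *)
Lemma addb_involution (T : finType) (P : pred T) (h : T -> T) (G : T -> bool) :
  (forall p, P p -> P (h p)) -> (forall p, P p -> h (h p) = p) ->
  (forall p, P p -> h p != p) -> (forall p, P p -> G (h p) = G p) ->
  \big[addb/false]_(p | P p) G p = false.
Proof.
move=> Ph hK hN Gh; pose r p := (enum_rank p < enum_rank (h p))%N.
rewrite (bigID r) /= [X in _ (+) X](reindex_onto h h) => [|p /andP[/hK//]].
rewrite [X in _ (+) X](eq_big (fun p => P p && r p) G) ?addbb // => p.
  rewrite /r; apply/idP/idP => [/andP[/andP[Php]]|/andP[Pp lt]].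
    move=> nlt /eqP hhp.
    have Pp : P p by rewrite -hhp Ph.
    rewrite Pp ltn_neqAle; move: nlt; rewrite hhp -leqNgt => ->.
    by rewrite andbT; apply: contra (hN _ Pp) => /eqP/val_inj/enum_rank_inj <-.
  by rewrite Ph // hK // eqxx andbT -leqNgt ltnW.
by case/andP=> /andP[Php _] /eqP hhp; rewrite -[in RHS]hhp [RHS]Gh.
Qed.

Section Delivery.
Variables (T : finType) (D : finType) (d : T -> D).

(** [w i S] stands for one bit of file [i] cached exactly by the users in [S]. Each user of [A] then
    knows every term but its own. *)
Definition xor_signal (w : D -> {set T} -> bool) (A : {set T}) : bool :=
  \big[addb/false]_(k in A) w (d k) (A :\ k).

Variable U : {set T}.
Hypothesis dU_inj : {in U &, injective d}.
Hypothesis dU_onto : forall k, d k \in d @: U.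

(** The alternative sets of leaders inside [B]: the cardinality condition forces [d] to be injective
    on [V], as it is on [U]. *)
Definition leader_choice (B V : {set T}) :=
  [&& V \subset B, d @: V == d @: U & #|V| == #|U|].

(* Expand the signals: the terms are indexed by V and k in B \ V, and exchanging
   k with the member of V that has the same demand as k pairs up equal terms. *)
Lemma xor_signal_relation w (B : {set T}) : U \subset B ->
  \big[addb/false]_(V | leader_choice B V) xor_signal w (B :\: V) = false.
Proof.
move=> sUB; rewrite /xor_signal pair_big_dep /=.
(* The default [p.2] is never reached on the index set: some member of [V] shares the demand of
   [k]. *)
pose partner (p : {set T} * T) :=
  odflt p.2 [pick v in p.1 | d v == d p.2].
pose h p := (p.2 |: (p.1 :\ partner p), partner p).
have pP V k : leader_choice B V -> k \in B :\: V ->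
    [/\ partner (V, k) \in V, d (partner (V, k)) = d k &
        forall v, v \in V -> d v = d k -> v = partner (V, k)].
  case/and3P=> sVB /eqP dV /eqP cV _.
  have injV : {in V &, injective d}.
    by apply/imset_injP; rewrite dV cV; apply/imset_injP.
  rewrite /partner; case: pickP => [v /= /andP[vV /eqP dv]|no].
    by split=> // v' v'V dv'; apply: injV => //; rewrite dv'.
  have := dU_onto k; rewrite -dV => /imsetP[v vV dkv].
  by have := no v; rewrite /= vV dkv eqxx.
have hP V k : leader_choice B V -> k \in B :\: V ->
    leader_choice B (h (V, k)).1 && ((h (V, k)).2 \in B :\: (h (V, k)).1).
  move=> LV kBV; have [vV dv uv] := pP _ _ LV kBV.
  case/and3P: LV => sVB /eqP dV /eqP cV.
  move: kBV; rewrite inE => /andP[kV kB] /=.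
  set v := partner _ in vV dv uv *.
  have nvk : v != k by apply: contraNneq kV => <-.
  apply/andP; split; last first.
    by rewrite !inE eqxx /= orbF nvk (fintype.subsetP sVB).
  apply/and3P; split.
  - by rewrite finset.subUset finset.sub1set kB (fintype.subset_trans (subsetDl _ _)).
  - by rewrite imsetU1 -dv -imsetU1 finset.setD1K // dV.
  - rewrite cardsU1 !inE negb_and kV orbT -cV (cardsD1 v V) vV.
    by rewrite eqxx.
apply: (@addb_involution _ _ h) => [[V k]|[V k]|[V k]|[V k]] /= /andP[LV kBV].
- exact: hP.
- have [vV dv uv] := pP _ _ LV kBV.
  have /andP[LV' kBV'] := hP _ _ LV kBV.
  have [vV' dv' uv'] := pP _ _ LV' kBV'.
  move: (kBV); rewrite inE => /andP[kV kB] /=.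
  rewrite /h /= in uv' *.
  have kE : k = partner (k |: V :\ partner (V, k), partner (V, k)).
    by apply: uv'; rewrite ?setU11.
  rewrite -kE; congr pair; apply/setP => x; rewrite !inE.
  have [->|nx] := eqVneq x (partner (V, k)); first by rewrite vV.
  have [->|] := eqVneq x k; first by rewrite (negPf kV).
  by [].
- have [vV dv uv] := pP _ _ LV kBV.
  move: kBV; rewrite inE => /andP[kV kB].
  by apply: contraNneq kV; rewrite /h /= => -[_ <-].
- have [vV dv uv] := pP _ _ LV kBV.
  move: kBV; rewrite inE => /andP[kV kB].
  rewrite dv; congr (w _ _); apply/setP => x; rewrite !inE.
  have [->|nx] := eqVneq x (partner (V, k)); first by rewrite vV /= andbF.
  by have [->|] := eqVneq x k.
Qed.

(** If [A] is disjoint from [U], apply the relation to [B = A :|: U]. The choice [V = U] contributes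
    the signal of [A]; any other [V] misses a leader and has the size of [U], so it contributes the
    signal of a set of size [m] meeting [U]. *)
Lemma xor_signal_determined w w' m :
  (forall A : {set T}, #|A| = m -> ~~ [disjoint A & U] ->
     xor_signal w A = xor_signal w' A) ->
  forall A : {set T}, #|A| = m -> xor_signal w A = xor_signal w' A.
Proof.
move=> eqw A cA; have [dAU|] := boolP [disjoint A & U]; last exact: eqw.
have LU : leader_choice (A :|: U) U by rewrite /leader_choice finset.subsetUr !eqxx.
have AE : (A :|: U) :\: U = A.
  by rewrite finset.setDUl finset.setDv finset.setU0; apply/finset.setDidPl.
have key v : xor_signal v A = \big[addb/false]_(V | leader_choice (A :|: U) V && (V != U))
     xor_signal v ((A :|: U) :\: V).
  have := xor_signal_relation v (finset.subsetUr A U).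
  rewrite (bigD1 U) //= AE => /(canRL (addKb _)).
  by rewrite addbF => ->.
rewrite !key; apply: eq_bigr => V /andP[/and3P[sV _ /eqP cV] nVU].
apply: eqw.
  have := cardsUI A U; rewrite (disjoint_setI0 dAU) cards0 addn0 => cAU.
  by rewrite cardsD (finset.setIidPr sV) cV cAU addnK.
have /subsetPn[u uU uV] : ~~ (U \subset V).
  by apply: contra nVU => sUV; rewrite eq_sym eqEcard sUV cV /=.
by rewrite -setI_eq0; apply/set0Pn; exists u; rewrite !inE uU uV orbT.
Qed.

(** Every term but that of [k] involves a set containing [k], so it lies in the cache of [k] and
    cancels. *)
Lemma xor_signal_decode w w' k (S : {set T}) : k \notin S ->
  (forall i (A : {set T}), k \in A -> w i A = w' i A) ->
  xor_signal w (k |: S) = xor_signal w' (k |: S) -> w (d k) S = w' (d k) S.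
Proof.
move=> kS eqw; rewrite /xor_signal !big_setU1 //= !setU1K //.
rewrite [in X in X = _](eq_bigr (fun k' => w' (d k') ((k |: S) :\ k'))) => [|k' k'S].
  exact: addIb.
by apply: eqw; rewrite !inE eqxx andbT; apply: contraNneq kS => ->.
Qed.
End Delivery.

(** * Counting *)

Lemma sum_subsets (T : finType) (B : {set T}) (f : nat -> nat) :
  \sum_(A : {set T} | A \subset B) f #|A| = \sum_(n < #|T|.+1) 'C(#|B|, n) * f n.
Proof.
rewrite (partition_big (fun A : {set T} => inord #|A| : 'I_#|T|.+1) predT) //=.
apply: eq_bigr => n _.
have cE (A : {set T}) : (inord #|A| == n) = (#|A| == n).
  by rewrite -val_eqE /= inordK // ltnS max_card.
under eq_bigl do rewrite cE.
rewrite (eq_bigr (fun=> f n)) => [|A /andP[_ /eqP->]//].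
rewrite sum_nat_const -cards_draws; congr (_ * _).
by apply: eq_card => A; rewrite inE.
Qed.

(** List each set followed by its complement, and match the two lists position by position. *)
Lemma perm_onto_set (T : finType) (A B : {set T}) : #|A| = #|B| ->
  exists s : {perm T}, s @: A = B.
Proof.
pose l (C : {set T}) := enum C ++ enum (~: C).
have szl (C : {set T}) : size (l C) = #|T| by rewrite size_cat -!cardE cardsC.
have ul C : uniq (l C).
  rewrite cat_uniq !enum_uniq /= andbT; apply/hasPn => x.
  by rewrite !mem_enum inE.
have ml C x : x \in l C by rewrite mem_cat !mem_enum inE orbN.
move=> cAB; pose f x := nth x (l B) (index x (l A)).
have ltf x : (index x (l A) < size (l B))%N by rewrite szl -(szl A) index_mem.
have f_inj : injective f.
  move=> x y; rewrite /f (set_nth_default y) // => /eqP.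
  rewrite nth_uniq // => /eqP ixy.
  by rewrite -(nth_index x (ml A x)) ixy nth_index.
exists (perm f_inj); apply/eqP; rewrite eqEcard.
rewrite card_imset ?cAB ?leqnn ?andbT; last exact: perm_inj.
apply/fintype.subsetP => _ /imsetP[x xA ->]; rewrite permE /f.
have ix : (index x (l A) < size (enum B))%N.
  by rewrite -cardE -cAB /l index_cat mem_enum xA cardE index_mem mem_enum.
by rewrite /l nth_cat ix -mem_enum mem_nth.
Qed.

(* The number of permutations depends only on the size of A, so the left-hand
   side counts pairs of a permutation and an #|A|-subset. *)
Lemma card_perm_disjoint (T : finType) (A S : {set T}) :
  #|[set s : {perm T} | [disjoint s @: A & S]]| * 'C(#|T|, #|A|) =
  #|{perm T}| * 'C(#|T| - #|S|, #|A|).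
Proof.
pose h (B : {set T}) := \sum_(s : {perm T}) [disjoint s @: B & S].
have hE (B : {set T}) : #|[set s : {perm T} | [disjoint s @: B & S]]| = h B.
  by rewrite /h -big_mkcond sum1dep_card.
have h_eq (B : {set T}) : #|B| = #|A| -> h B = h A.
  move/esym/perm_onto_set => [s <-]; rewrite /h [RHS](reindex_inj (mulgI s)) /=.
  apply: eq_bigr => u _; rewrite -imset_comp.
  by rewrite (@eq_imset _ _ _ (s * u)%g) // => x; rewrite permM.
rewrite hE -card_draws mulnC -sum_nat_const.
rewrite (eq_bigr h) => [|B]; last by rewrite inE => /eqP/h_eq.
rewrite /h exchange_big /= -sum_nat_const; apply: eq_bigr => s _.
rewrite -big_mkcondr -(cardsC S) addKn -cards_draws -[RHS]sum1_card /=.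
rewrite [RHS](reindex_inj (imset_inj (@perm_inj _ s))) /=.
apply: eq_bigl => B; rewrite !inE finset.disjoints_subset.
by rewrite card_imset 1?andbC //; exact: perm_inj.
Qed.


(** Both sides count pairs of disjoint subsets of sizes [n] and [i]. *)
Lemma bin_swap K n i : 'C(K, n) * 'C(K - n, i) = 'C(K, i) * 'C(K - i, n).
Proof.
have [le|gt] := leqP (n + i) K; last first.
  have [nK|Kn] := leqP n K; last first.
    by rewrite bin_small // [X in _ = _ * X]bin_small ?muln0 //; lia.
  rewrite [X in _ * X = _]bin_small ?muln0; last lia.
  have [iK|Ki] := leqP i K; last by rewrite bin_small ?muln0.
  by rewrite [X in _ = _ * X]bin_small ?muln0; lia.
have e1 := @bin_fact K n ltac:(lia).
have e2 := @bin_fact K i ltac:(lia).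
have e3 := @bin_fact (K - n) i ltac:(lia).
have e4 := @bin_fact (K - i) n ltac:(lia).
have eqs : K - n - i = K - i - n by lia.
rewrite eqs in e3.
have pos : 0 < n`! * i`! * (K - i - n)`! by rewrite !muln_gt0 !fact_gt0.
apply/eqP; rewrite -(eqn_pmul2r pos); apply/eqP.
have -> : 'C(K, n) * 'C(K - n, i) * (n`! * i`! * (K - i - n)`!) = K`!.
  by rewrite -e1 -e3; ring.
by rewrite -e2 -e4; ring.
Qed.

Lemma bin_hockey K n m : m <= K ->
  'C(K, n.+1) = 'C(K - m, n.+1) + \sum_(i < m) 'C(K - i.+1, n).
Proof.
elim: m => [|m IH] mK; first by rewrite subn0 big_ord0 addn0.
rewrite big_ord_recr /= IH; last lia.
have -> : K - m = (K - m.+1).+1 by lia.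
by rewrite binS; ring.
Qed.

(** Convexity of ['C(x, j.+1)] in [x]: by Pascal's rule its increment at [x] is ['C(x, j)], which is
    nondecreasing. *)
Lemma bin_tangent_up x k j : 'C(x, j.+1) + k * 'C(x, j) <= 'C(x + k, j.+1).
Proof.
elim: k => [|k IH]; first by rewrite mul0n !addn0.
have := @leq_bin2l x (x + k) j (leq_addr _ _).
by rewrite addnS binS; lia.
Qed.

Lemma bin_tangent_down x k j : 'C(x + k, j.+1) <= 'C(x, j.+1) + k * 'C(x + k, j).
Proof.
elim: k => [|k IH]; first by rewrite mul0n !addn0.
have := @leq_bin2l (x + k) (x + k.+1) j ltac:(lia).
by rewrite addnS binS; nia.
Qed.

Local Open Scope ring_scope.

(** The left-hand side is the line through the points [n = p] and [n = p.+1] of a convex sequence.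
    The two tangent bounds, taken around [y = K - p.+1], treat the two sides of it. *)
Lemma bin_support_line (R : realFieldType) K p n j : (p < K)%N -> (n <= K)%N ->
  'C(K - p, j.+1)%:R - 'C(K - p.+1, j)%:R * (n%:R - p%:R) <= 'C(K - n, j.+1)%:R :> R.
Proof.
move=> pK nK; have -> : (K - p = (K - p.+1).+1)%N by lia.
set y := (K - p.+1)%N; rewrite binS natrD.
have eK : K%:R = y%:R + p%:R + 1 :> R.
  by rewrite -natrD natr1; congr (_%:R); rewrite /y; lia.
have eK' : K%:R = (K - n)%:R + n%:R :> R by rewrite -natrD subnK.
have -> : n%:R - p%:R = y%:R + 1 - (K - n)%:R :> R by lra.
have [le|lt] := leqP y (K - n).
  have := bin_tangent_up y (K - n - y) j.
  by rewrite subnKC // -(ler_nat R) natrD natrM natrB //; lra.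
have := bin_tangent_down (K - n) (y - (K - n)) j; rewrite subnKC ?(ltnW lt) //.
by rewrite -(ler_nat R) natrD natrM natrB ?(ltnW lt) //; lra.
Qed.

(** Writes the rate as a nonnegative combination of binomials in [K - n], from which convexity and
    monotonicity in [n] are read off termwise. *)
Lemma rate_coeffE (R : realFieldType) K n m : (n <= K)%N -> (m <= K)%N ->
  ('C(K, n.+1)%:R - 'C(K - m, n.+1)%:R) / 'C(K, n)%:R =
  \sum_(i < m) 'C(K - n, i.+1)%:R / 'C(K, i.+1)%:R :> R.
Proof.
move=> nK mK; rewrite (bin_hockey n mK) natrD addrC addKr natr_sum mulr_suml.
apply: eq_bigr => i _.
have iK : (i < K)%N by apply: leq_trans mK.
apply/eqP; rewrite eqr_div ?pnatr_eq0 -?lt0n ?bin_gt0 // -!natrM.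
by rewrite mulnC -bin_swap mulnC.
Qed.

(** The slope function [s] is chosen before [m], so that the lines can later be averaged over
    demands with [m = Ne d]. *)
Lemma rate_coeff_support_line (R : realFieldType) K p : (p < K)%N ->
  exists2 s : nat -> R, forall m, s m <= 0 &
  forall m, (m <= K)%N ->
  let c n := ('C(K, n.+1)%:R - 'C(K - m, n.+1)%:R) / 'C(K, n)%:R in
  c p.+1 = c p + s m /\
  (forall n, (n <= K)%N -> c p + s m * (n%:R - p%:R) <= c n).
Proof.
move=> pK; exists (fun m => - \sum_(i < m) 'C(K - p.+1, i)%:R / 'C(K, i.+1)%:R).
  by move=> m; rewrite oppr_le0 sumr_ge0 // => i _; rewrite divr_ge0.
move=> m mK c; rewrite /c; split=> [|n nK].
  rewrite !rate_coeffE //; last exact: ltnW.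
  rewrite -sumrB; apply: eq_bigr => i _.
  have -> : (K - p = (K - p.+1).+1)%N by lia.
  by rewrite binS natrD mulrDl addrK.
rewrite !rate_coeffE //; last exact: ltnW.
rewrite mulNr mulr_suml -sumrB; apply: ler_sum => i _.
by rewrite mulrAC -mulrBl ler_wpM2r ?invr_ge0 // bin_support_line.
Qed.

(** * Converse *)

Section Converse.
Variables (R : realType) (N K F : nat).
Implicit Types (P : prefetching N K F) (d : demand N K) (w : library N F).

(* The list is in reverse order of decoding: the head of us is decoded last,
   with the help of the caches of all the users in us. *)
Fixpoint unknown_bits P d (us : seq 'I_K) : {set bitidx N F} :=
  if us is u :: us' then
    finset (fun b : bitidx N F => (b.1 == d u) && all (fun k => b \notin P k) us)
      :|: unknown_bits P d us'
  else finset.set0.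

Lemma unknown_bits_file P d us b :
  b \in unknown_bits P d us -> b.1 \in map d us.
Proof.
elim: us => [|u us IH] /=; rewrite !inE //.
by case/orP => [/andP[/eqP-> _]|/IH->]; rewrite ?eqxx ?orbT.
Qed.

(** Induction on the list: a cached bit of the head [u] that is unknown for the tail lies in a file
    recovered already. [key] asks for agreement only on bits cached by a user of the list, because
    these do not become unknown when a user is added in front. *)
Lemma unknown_bits_decode P d us w w' :
  (forall k, cache_content (P k) w = cache_content (P k) w' ->
     file_of w (d k) = file_of w' (d k)) ->
  (forall b, b \notin unknown_bits P d us -> w b = w' b) -> w = w'.
Proof.
move=> dec eq_out.
have key us' : (forall b, has (fun k => b \in P k) us' ->
      b \notin unknown_bits P d us' -> w b = w' b) ->
    forall b, b.1 \in map d us' -> w b = w' b.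
  elim: us' => //= u us' IH eq_known.
  have eq_us' : forall b, b.1 \in map d us' -> w b = w' b.
    apply: IH => b bP bU; apply: eq_known; first by rewrite bP orbT.
    rewrite !inE negb_or bU andbT !negb_and -has_predC.
    by rewrite (@eq_has _ _ (fun k => b \in P k)) ?bP ?orbT // => k /=; rewrite negbK.
  move=> [f j]; rewrite inE => /orP[/eqP/= ->|]; last exact: eq_us'.
  have -> : w (d u, j) = file_of w (d u) j by rewrite ffunE.
  rewrite dec ?ffunE //; apply/ffunP => b; rewrite !ffunE.
  have [bP|//] := boolP (b \in P u).
  have [/unknown_bits_file/eq_us' //|bU] := boolP (b \in unknown_bits P d us').
  by apply: eq_known; rewrite ?bP // !inE bP /= andbF.
apply/ffunP => b.
have [/unknown_bits_file/key|/eq_out//] := boolP (b \in unknown_bits P d us).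
by apply=> b' _; exact: eq_out.
Qed.

(** On correctly decoded libraries, the message and the library with its unknown bits erased form an
    injective encoding. A union bound over the users shows that these are at least half of all
    libraries; the factor of two costs the extra bit. *)
Lemma card_unknown_bits_le (eps : R) d P L us : eps * (2 * K.+1)%:R <= 1 ->
  achievable_len eps d P L -> (#|unknown_bits P d us| <= L.+1)%N.
Proof.
move=> heps [psi [mu hmu]].
set U := unknown_bits P d us.
pose bad k := finset (fun w : library N F =>
  mu k (psi w) (cache_content (P k) w) != file_of w (d k)).
pose good := finset (fun w => [forall k, w \notin bad k]).
have card_lib : #|{: library N F}| = (2 ^ (N * F))%N.
  by rewrite card_ffun card_bool card_prod !card_ord.
have card_bad k : #|bad k|%:R <= eps * (2 ^ (N * F))%:R.
  rewrite -ler_pdivrMr ?ltr0n ?expn_gt0 //; apply: le_trans (hmu k).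
  rewrite /err_prob ler_wpM2r ?invr_ge0 // ler_nat.
  apply/eq_leq/eq_card => w; rewrite finset.in_set.
  by apply/idP/idP => [h|/set_mem//]; exact: mem_set.
have card_notgood : #|~: good|%:R * 2 <= (2 ^ (N * F))%:R :> R.
  have : (#|~: good| <= \sum_(k : 'I_K) #|bad k|)%N.
    have -> : ~: good = (\bigcup_(k : 'I_K) bad k)%SET.
      apply/setP => w; rewrite !inE negb_forall; apply/existsP/bigcupP.
        by case=> k; rewrite negbK => ?; exists k.
      by case=> k _ ?; exists k; rewrite negbK.
    elim/big_rec2: _ => [|k A m _ le]; first by rewrite cards0.
    by rewrite (leq_trans (leq_card_setU _ _)) // leq_add2l.
  rewrite -(ler_nat R) natr_sum => le1.
  have le2 : \sum_(k : 'I_K) #|bad k|%:R <= K%:R * (eps * (2 ^ (N * F))%:R).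
    by rewrite mulr_natl -[K in _ *+ K]card_ord -sumr_const ler_sum.
  have := expn_gt0 2 (N * F); rewrite -(ltr_nat R) /= => p2.
  move: heps; rewrite natrM -natr1 => heps.
  move: (le_trans le1 le2); set x := (2 ^ _)%:R in p2 *; move: (#|_|%:R) => y lexy.
  have [eps0|eps0] := leP eps 0.
    have : K%:R * (eps * x) <= 0 by rewrite mulr_ge0_le0 // mulr_le0_ge0 // ?(ltW p2).
    by lra.
  have : 0 < eps * x by rewrite mulr_gt0.
  have x0 := ltW p2; have := ler_wpM2r x0 heps.
  by move: lexy (mulr_gt0 eps0 p2); nra.
have card_good : (2 ^ (N * F) <= 2 * #|good|)%N.
  rewrite -(ler_nat R) natrM; move: card_notgood.
  have := cardsC good; rewrite card_lib => /(congr1 (fun n => n%:R : R)).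
  by rewrite natrD; lra.
pose enc w := (psi w, [ffun b => (b \notin U) && w b] : library N F).
have enc_inj : {in good &, injective enc}.
  move=> w w'; rewrite !inE => /forallP gw /forallP gw' [eqpsi /ffunP eqU].
  apply: (@unknown_bits_decode P d us) => [k eqc|b bU].
    move: (gw k) (gw' k); rewrite !inE !negbK => /eqP<- /eqP<-.
    by rewrite eqpsi eqc.
  by have := eqU b; rewrite !ffunE /U bU.
have : (#|good| <= 2 ^ L * 2 ^ #|~: U|)%N.
  have <- : #|[set: message L]| = (2 ^ L)%N.
    by rewrite cardsT card_ffun card_bool card_ord.
  have <- : #|finset (mem (pffun_on false (mem (~: U)) predT))| = (2 ^ #|~: U|)%N.
    by rewrite cardsE card_pffun_on card_bool.
  rewrite -cardsX -(card_in_imset enc_inj); apply/subset_leq_card/fintype.subsetP.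
  move=> _ /imsetP[w _ ->]; rewrite finset.in_setX finset.in_setT /= finset.inE.
  apply/pffun_onP; split=> [|b _ //]; apply/fintype.subsetP => b.
  by rewrite !inE /= ffunE; case: (b \in U).
move=> le; have {le card_good} : (2 ^ (N * F) <= 2 ^ (1 + L + #|~: U|))%N.
  by rewrite !expnD expn1 -mulnA (leq_trans card_good) // leq_mul2l.
rewrite leq_exp2l //; have := cardsC U.
by rewrite card_prod !card_ord => <-; lia.
Qed.

End Converse.

(** The decoder returns the requested file of any library compatible with the message and the cache;
    all such libraries agree on that file. *)
Lemma zero_error_achievable (R : realType) (N K F : nat) (eps : R)
    (d : demand N K) (P : prefetching N K F) (Q : finType) (L : nat)
    (enc : library N F -> {ffun Q -> bool}) :
  0 <= eps -> #|Q| = L ->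
  (forall k w w', enc w = enc w' ->
     cache_content (P k) w = cache_content (P k) w' ->
     file_of w (d k) = file_of w' (d k)) ->
  achievable_len eps d P L.
Proof.
move=> eps0 cQ dec; case: _ / cQ.
pose psi w : message #|Q| := [ffun i => enc w (enum_val i)].
have psi_inj w w' : psi w = psi w' -> enc w = enc w'.
  move=> /ffunP e; apply/ffunP => q.
  by have := e (enum_rank q); rewrite !ffunE enum_rankK.
pose mu k x c := if [pick w | (psi w == x) && (cache_content (P k) w == c)] is Some w
                 then file_of w (d k) else [ffun=> false].
exists psi, mu => k; rewrite /err_prob.
rewrite (eq_card0 (A := _)) ?mul0r // => w; apply/negP => /set_mem /= /eqP[].
rewrite /mu; case: pickP => [w' /andP[/eqP/psi_inj e /eqP c]|/(_ w)].
  exact: dec.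
by rewrite !eqxx.
Qed.

Lemma natr_card_set (R : pzSemiRingType) (T : finType) (p : pred T) :
  #|finset p|%:R = \sum_x (p x)%:R :> R.
Proof.
by rewrite -sum1dep_card natr_sum big_mkcond; apply: eq_bigr => x _; case: (p x).
Qed.

(** * Averaging over relabellings of users and files *)

Section Symmetrization.
Variables (R : realType) (N K F : nat).
Implicit Types (P : prefetching N.+1 K F) (d : demand N.+1 K).

Definition holders P b : {set 'I_K} := finset (fun k => b \in P k).

(** Files are relabelled by cyclic shifts only, which already carry any file to any other; [N.+1]
    provides the group structure on ['I_N.+1]. *)
Definition relabel (s : {perm 'I_K}) (c : 'I_N.+1) d : demand N.+1 K :=
  [ffun k => d (s^-1%g k) + c].

Lemma relabel_bij s c : bijective (relabel s c).
Proof.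
exists (relabel s^-1%g (- c)) => d; apply/ffunP => k; rewrite !ffunE.
  by rewrite invgK permK addrK.
by rewrite invgK permKV subrK.
Qed.

Lemma map_relabel s c d us :
  map (relabel s c d) (map s us) = map (fun k => d k + c) us.
Proof.
by rewrite -map_comp; apply: eq_map => k; rewrite /= ffunE permK.
Qed.

(** The demands being distinct, the layers of unknown bits added by successive users are disjoint. A
    bit lies in the layer of [u] for exactly one shift and for the permutations moving [u :: us] off
    its holders, which [card_perm_disjoint] counts. *)
Lemma sum_card_unknown_bits P d us : uniq (map d us) ->
  \sum_(s : {perm 'I_K}) \sum_(c : 'I_N.+1)
     #|unknown_bits P (relabel s c d) (map s us)|%:R =
  #|{perm 'I_K}|%:R * \sum_(b : bitidx N.+1 F) \sum_(i < size us)
     'C(K - #|holders P b|, i.+1)%:R / 'C(K, i.+1)%:R :> R.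
Proof.
elim: us => [|u us IH] uniq_us.
  rewrite /= big1 => [|s _]; last by rewrite big1 // => c _; rewrite cards0.
  by rewrite big1 ?mulr0 // => b _; rewrite big_ord0.
pose layer s c := finset (fun b : bitidx N.+1 F =>
  (b.1 == relabel s c d (s u)) && all (fun k => b \notin P k) (map s (u :: us))).
have cardU s c : #|unknown_bits P (relabel s c d) (map s (u :: us))| =
    (#|layer s c| + #|unknown_bits P (relabel s c d) (map s us)|)%N.
  rewrite /= -/(layer s c) cardsU disjoint_setI0 ?cards0 ?subn0 //.
  rewrite -setI_eq0; apply/eqP/setP => b; rewrite !inE.
  apply/negP => /andP[/andP[/eqP b1 _] /unknown_bits_file].
  rewrite map_relabel b1 ffunE permK => /mapP[v vus /addIr duv].
  by move: uniq_us; rewrite /= duv map_f.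
under eq_bigr => s _ do under eq_bigr => c _ do rewrite cardU natrD.
under eq_bigr => s _ do rewrite big_split.
rewrite big_split /= IH; last by case/andP: uniq_us.
under [in RHS]eq_bigr => b _ do rewrite big_ord_recr /=.
rewrite big_split /= mulrDr addrC; congr (_ + _).
rewrite mulr_sumr.
have layerE s c : #|layer s c|%:R = \sum_(b : bitidx N.+1 F)
    ((b.1 == d u + c) && [disjoint s @: [set x in u :: us]%SET & holders P b])%:R :> R.
  rewrite natr_card_set; apply: eq_bigr => b _.
  rewrite ffunE permK; congr ((nat_of_bool (_ && _))%:R).
  apply/allP/idP => [h|].
    rewrite -setI_eq0; apply/eqP/setP => k; rewrite !inE; apply/negP.
    case/andP => /imsetP[v]; rewrite inE => vus ->.
    by apply/negP; apply: h; rewrite map_f.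
  move=> dis k /mapP[v vus ->]; have := disjointFr dis (x := s v).
  by rewrite inE => -> //; apply: imset_f; rewrite inE.
under eq_bigr => s _ do under eq_bigr => c _ do rewrite layerE.
under eq_bigr => s _ do rewrite exchange_big.
rewrite exchange_big; apply: eq_bigr => b _ /=.
have -> : \sum_(s : {perm 'I_K}) \sum_(c : 'I_N.+1)
    ((b.1 == d u + c) && [disjoint s @: [set x in u :: us]%SET & holders P b])%:R =
    #|finset (fun s : {perm 'I_K} =>
        [disjoint s @: [set x in u :: us]%SET & holders P b])|%:R :> R.
  rewrite natr_card_set; apply: eq_bigr => s _.
  rewrite (bigD1 (b.1 - d u)) //= (addrC (d u)) subrK eqxx big1 => [|c nc].
    by rewrite addr0.
  rewrite [_ == _](_ : _ = false) //; apply: contraNF nc => /eqP->.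
  by rewrite addrC addKr.
have uniq_uus : uniq (u :: us) by apply: map_uniq uniq_us.
have card_us : #|[set x in u :: us]%SET| = size (u :: us).
  by rewrite cardsE; apply/card_uniqP.
have sz : (size (u :: us) <= K)%N.
  by rewrite -card_us -[K in (_ <= K)%N]card_ord max_card.
have := card_perm_disjoint [set x in u :: us]%SET (holders P b).
rewrite card_us card_ord mulrA -natrM => <-.
by rewrite natrM mulfK // pnatr_eq0 -lt0n bin_gt0.
Qed.

End Symmetrization.

Lemma achievable_len_uncoded (R : realType) (N K F : nat) (eps : R)
  (d : demand N K) (P : prefetching N K F) :
  0 <= eps -> achievable_len eps d P (N * F).
Proof.
move=> eps0; apply: (zero_error_achievable (Q := bitidx N F) (enc := id)) => //.
  by rewrite card_prod !card_ord.
by move=> k w w' ->.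
Qed.

Lemma ex_leaders (N K : nat) (d : {ffun 'I_K -> 'I_N}) :
  exists2 us : seq 'I_K, uniq (map d us) & size us = Ne d.
Proof.
have [us dus] : exists us, map d us = enum (imset d (mem 'I_K)).
  have : {subset enum (imset d (mem 'I_K)) <= imset d (mem 'I_K)}.
    by move=> f; rewrite mem_enum.
  elim: (enum _) => [_|f s IH sub]; first by exists [::].
  have [g gs|us <-] := IH; first by apply: sub; rewrite inE gs orbT.
  have /imsetP[k _ ->] := sub f (mem_head _ _).
  by exists (k :: us).
exists us; first by rewrite dus enum_uniq.
by rewrite -(size_map d) dus -cardE.
Qed.

Lemma Ne_leq (N K : nat) (d : {ffun 'I_K -> 'I_N}) : (Ne d <= K)%N.
Proof. by rewrite -[K in (_ <= K)%N]card_ord leq_imset_card. Qed.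

(** * Lower bound for a fixed file size *)

Section LowerBound.
Variables (R : realType) (N K F : nat).
Implicit Types (P : prefetching N.+1 K F) (d : demand N.+1 K).

Lemma Rstar_eps_d_ge (eps : R) d P us : 0 <= eps -> eps * (2 * K.+1)%:R <= 1 ->
  (#|unknown_bits P d us|%:R - 1) / F%:R <= Rstar_eps_d eps d P.
Proof.
move=> eps0 heps; apply: lb_le_inf.
  exists ((N.+1 * F)%:R / F%:R), (N.+1 * F)%N => //=.
  exact: achievable_len_uncoded.
move=> _ [L /= hL <-]; rewrite ler_wpM2r ?invr_ge0 //.
have := card_unknown_bits_le us heps hL; rewrite -(ler_nat R) -natr1; lra.
Qed.

Lemma Rstar_eps_ge (eps : R) P : (0 < F)%N -> 0 <= eps -> eps * (2 * K.+1)%:R <= 1 ->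
  (\sum_(b : bitidx N.+1 F) Rformula R N.+1 K #|holders P b|) / (N.+1 * F)%:R - F%:R^-1
    <= Rstar_eps eps P.
Proof.
move=> F0 eps0 heps.
have nz n : (0 < n)%N -> n%:R != 0 :> R by rewrite pnatr_eq0 -lt0n.
pose p : R := #|{perm 'I_K}|%:R.
have p0 : 0 < p by rewrite ltr0n; apply/card_gt0P; exists 1%g.
(* Each relabelling permutes the demands, so it leaves the sum over [d] unchanged; [P] itself is not
   relabelled. *)
have symm : p * N.+1%:R * \sum_d Rstar_eps_d eps d P =
    \sum_d \sum_(s : {perm 'I_K}) \sum_(c : 'I_N.+1) Rstar_eps_d eps (relabel s c d) P.
  rewrite exchange_big /= /p -mulrA mulr_natl -sumr_const; apply: eq_bigr => s _.
  rewrite exchange_big /= mulr_natl -[X in _ *+ X]card_ord -sumr_const.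
  by apply: eq_bigr => c _; rewrite (reindex _ (onW_bij _ (relabel_bij s c))).
have lower d : (p * \sum_b ('C(K, #|holders P b|.+1)%:R
      - 'C(K - Ne d, #|holders P b|.+1)%:R) / 'C(K, #|holders P b|)%:R
      - p * N.+1%:R) / F%:R <=
    \sum_(s : {perm 'I_K}) \sum_(c : 'I_N.+1) Rstar_eps_d eps (relabel s c d) P.
  have [us uniq_us szus] := ex_leaders d.
  under eq_bigr => b _.
    rewrite rate_coeffE ?Ne_leq //; last by rewrite -[K in (_ <= K)%N]card_ord max_card.
    over.
  rewrite -szus -(sum_card_unknown_bits R P uniq_us).
  have -> : p * N.+1%:R = \sum_(s : {perm 'I_K}) \sum_(c : 'I_N.+1) 1.
    by rewrite sumr_const sumr_const card_ord mulr_natl.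
  rewrite -sumrB mulr_suml; apply: ler_sum => s _.
  rewrite -sumrB mulr_suml; apply: ler_sum => c _.
  exact: Rstar_eps_d_ge.
have := @ler_sum R _ (index_enum _) predT _ _ (fun d _ => lower d).
rewrite -symm => {symm lower} le.
rewrite /Rstar_eps ler_pdivlMr ?ltr0n ?expn_gt0 //.
rewrite -(ler_pM2l p0) -(ler_pM2l (_ : 0 < N.+1%:R :> R)) ?ltr0n //.
rewrite [leRHS]mulrA [_ * p]mulrC; apply: le_trans le.
rewrite le_eqVlt; apply/orP; left; apply/eqP.
rewrite -[RHS]mulr_suml sumrB -mulr_sumr sumr_const card_ffun !card_ord.
rewrite -[\sum_b Rformula _ _ _ _]mulr_suml exchange_big /= natrM.
rewrite -mulr_natr; field.
by rewrite nat1r !nz ?expn_gt0.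
Qed.

Lemma sum_holders P : \sum_(b : bitidx N.+1 F) #|holders P b|%:R =
  \sum_(k : 'I_K) #|P k|%:R :> R.
Proof.
under eq_bigr do rewrite natr_card_set.
rewrite exchange_big; apply: eq_bigr => k _.
by rewrite -natr_card_set; congr (_%:R); apply: eq_card => b; rewrite inE.
Qed.

(** Apply the line to each bit and sum. The numbers of holders add up to the total cache use, at
    most [K * M * F], and [s <= 0] turns this into a lower bound. *)
Lemma Rstar_eps_min_ge (eps M a s : R) : (0 < F)%N -> 0 <= M -> 0 <= eps ->
  eps * (2 * K.+1)%:R <= 1 -> s <= 0 ->
  (forall n, (n <= K)%N -> a + s * n%:R <= Rformula R N.+1 K n) ->
  a + s * (K%:R * M / N.+1%:R) - F%:R^-1 <= Rstar_eps_min N.+1 K F eps M.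
Proof.
move=> F0 M0 eps0 heps s0 le_r; apply: lb_le_inf.
  pose P0 : prefetching N.+1 K F := [ffun=> finset.set0].
  exists (Rstar_eps eps P0), P0 => //= k.
  by rewrite ffunE cards0 mulr_ge0.
move=> _ [P /= vP <-]; apply: le_trans (Rstar_eps_ge P F0 eps0 heps).
rewrite lerD2r ler_pdivlMr ?ltr0n ?muln_gt0 //.
have le1 : \sum_(b : bitidx N.+1 F) (a + s * #|holders P b|%:R) <=
    \sum_(b : bitidx N.+1 F) Rformula R N.+1 K #|holders P b|.
  by apply: ler_sum => b _; apply: le_r; rewrite -[K in (_ <= K)%N]card_ord max_card.
apply: le_trans le1; rewrite big_split /= -mulr_sumr sum_holders sumr_const.
rewrite card_prod !card_ord -[a *+ _]mulr_natr mulrDl lerD2l -[s * _ * _]mulrA.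
apply: ler_wnM2l => //.
have -> : K%:R * M / N.+1%:R * (N.+1 * F)%:R = \sum_(k : 'I_K) M * F%:R.
  by rewrite sumr_const card_ord -mulr_natl natrM; field; rewrite nat1r pnatr_eq0.
by apply: ler_sum => k _; exact: vP.
Qed.

End LowerBound.

(** * Achievability *)

Lemma ex_leader_set (N K : nat) (d : {ffun 'I_K -> 'I_N}) :
  exists U : {set 'I_K}, [/\ {in U &, injective d},
    forall k, d k \in imset d (mem U) & #|U| = Ne d].
Proof.
have [us uniq_us szus] := ex_leaders d.
have cU : #|[set k in us]%SET| = Ne d.
  by rewrite cardsE -szus; apply/card_uniqP/(map_uniq uniq_us).
have d_inj : {in [set k in us]%SET &, injective d}.
  apply/imset_injP; rewrite cU.
  have -> : imset d (mem [set k in us]%SET) = [set f in map d us]%SET.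
    apply/setP => f; rewrite finset.inE.
    by apply/imsetP/mapP => -[k kus ->]; exists k; rewrite ?inE // in kus *.
  by rewrite cardsE (card_uniqP uniq_us) size_map szus.
exists [set k in us]%SET; split=> // k.
have -> : imset d (mem [set k in us]%SET) = imset d (mem 'I_K).
  apply/eqP; rewrite eqEcard (card_in_imset d_inj) cU leqnn andbT.
  by apply: imsetS; apply/fintype.subsetP.
exact: imset_f.
Qed.

Lemma card_dep_prod (T : finType) (F : nat) (Q : pred T) (c : T -> nat) :
  (forall x, Q x -> (c x <= F)%N) ->
  #|[pred p : T * 'I_F | Q p.1 && (p.2 < c p.1)%N]| = (\sum_(x | Q x) c x)%N.
Proof.
move=> cF; rewrite -sum1_card.
rewrite -(pair_big_dep Q (fun x (y : 'I_F) => (y < c x)%N) (fun _ _ => 1%N)) /=.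
apply: eq_bigr => x /cF le.
by rewrite -(big_ord_widen F (fun=> 1%N) le) sum1_card card_ord.
Qed.

(* [b n] is the number of bits, in each file, that are cached exactly by the
   users in S, for each set S of n users; [pos j = (S, x)] says that the j-th
   bit of every file is the x-th bit cached exactly by S. *)
Section Scheme.
Variables (N K F : nat) (b : nat -> nat).
Hypothesis b_sum : (\sum_(S : {set 'I_K}) b #|S|)%N = F.

Let b_le (S : {set 'I_K}) : (b #|S| <= F)%N.
Proof. by rewrite -b_sum (bigD1 S) //= leq_addr. Qed.

Lemma ex_layout : exists2 pos : 'I_F -> {set 'I_K} * 'I_F, injective pos &
  forall p : {set 'I_K} * 'I_F, (p.2 < b #|p.1|)%N = (p \in codom pos).
Proof.
pose J := [pred p : {set 'I_K} * 'I_F | predT p.1 && (p.2 < b #|p.1|)%N].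
have cJ : #|J| = F.
  by rewrite (@card_dep_prod _ F predT (fun S : {set 'I_K} => b #|S|)).
pose pos j := enum_val (cast_ord (esym cJ) j).
have pos_inj : injective pos by move=> i j /enum_val_inj/cast_ord_inj.
exists pos => // p; have -> : (p.2 < b #|p.1|)%N = (p \in J) by rewrite inE.
symmetry; move: p; apply/subset_cardP; first by rewrite card_codom // cJ card_ord.
by apply/fintype.subsetP => _ /codomP[j ->]; exact: enum_valP.
Qed.

Definition placement (pos : 'I_F -> {set 'I_K} * 'I_F) : prefetching N K F :=
  [ffun k => finset (fun i : bitidx N F => k \in (pos i.2).1)].

Lemma card_placement pos k : injective pos ->
  (forall p : {set 'I_K} * 'I_F, (p.2 < b #|p.1|)%N = (p \in codom pos)) ->
  #|placement pos k| = (N * \sum_(S : {set 'I_K} | k \in S) b #|S|)%N.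
Proof.
move=> pos_inj pos_codom; rewrite ffunE.
have -> : finset (fun i : bitidx N F => k \in (pos i.2).1) =
    finset.setX [set: 'I_N]%SET (finset (fun j => k \in (pos j).1)).
  by apply/setP => -[i j]; rewrite !finset.inE.
rewrite cardsX cardsT card_ord; congr (_ * _)%N.
rewrite -(@card_dep_prod _ F (fun S : {set 'I_K} => k \in S)
  (fun S : {set 'I_K} => b #|S|)) => [|S _]; last exact: b_le.
rewrite -(card_imset _ pos_inj); apply: eq_card => p; rewrite !inE pos_codom.
apply/imsetP/andP => [[j]|[kp /codomP[j pE]]].
  by rewrite inE => kj ->; rewrite codom_f.
by exists j; rewrite // inE -pE.
Qed.

Variable pos : 'I_F -> {set 'I_K} * 'I_F.
Hypothesis pos_inj : injective pos.
Hypothesis pos_codom :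
  forall p : {set 'I_K} * 'I_F, (p.2 < b #|p.1|)%N = (p \in codom pos).

(** For fixed [x] this has the shape of the [w] of [xor_signal]; positions beyond the last bit of
    [S] are padded with [false]. *)
Definition subfile (w : library N F) (x : 'I_F) (i : 'I_N) (S : {set 'I_K}) :=
  if [pick j | pos j == (S, x)] is Some j then w (i, j) else false.

Lemma subfile_pos w i j : subfile w (pos j).2 i (pos j).1 = w (i, j).
Proof.
rewrite /subfile -surjective_pairing.
by case: pickP => [j' /eqP/pos_inj->|/(_ j)/eqP].
Qed.

Lemma placement_achievable (R : realType) (eps : R) (d : demand N K) : 0 <= eps ->
  exists2 U : {set 'I_K}, #|U| = Ne d &
  achievable_len eps d (placement pos)
    (\sum_(A : {set 'I_K} | ~~ [disjoint A & U]) b #|A|.-1).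
Proof.
move=> eps0; have [U [d_inj d_onto cU]] := ex_leader_set d; exists U => //.
(* The signal of [A] combines parts cached by sets of size [#|A|.-1], so it has [b #|A|.-1] bits.
   The empty [A], for which the predecessor is meaningless, is excluded as it does not meet [U]. *)
pose sent := [pred p : {set 'I_K} * 'I_F |
  ~~ [disjoint p.1 & U] && (p.2 < b #|p.1|.-1)%N].
pose enc (w : library N F) := [ffun q : {p | p \in sent} =>
  xor_signal d (subfile w (val q).2) (val q).1].
apply: (zero_error_achievable (enc := enc)) => //.
  rewrite card_sig (@card_dep_prod _ F (fun A : {set 'I_K} => ~~ [disjoint A & U])
    (fun A : {set 'I_K} => b #|A|.-1)) // => A.
  have [->|[k kA] _] := set_0Vmem A; first by rewrite -setI_eq0 finset.set0I eqxx.
  by have := b_le (A :\ k)%SET; rewrite (cardsD1 k A) kA add1n.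
move=> k w w' /ffunP eq_enc /ffunP eq_cache.
have cached i j : k \in (pos j).1 -> w (i, j) = w' (i, j).
  by move=> kj; have := eq_cache (i, j); rewrite !ffunE finset.inE kj.
apply/ffunP => j; rewrite !ffunE.
have [kj|kj] := boolP (k \in (pos j).1); first exact: cached.
have jb : ((pos j).2 < b #|(pos j).1|)%N by rewrite pos_codom codom_f.
rewrite -!subfile_pos; apply: (xor_signal_decode kj) => [i A kA|].
  by rewrite /subfile; case: pickP => // j' /eqP pj'; apply: cached; rewrite pj'.
apply: (xor_signal_determined d_inj d_onto (m := #|(pos j).1|.+1)); last first.
  by rewrite cardsU1 kj.
move=> A cA AU; have Ax : (A, (pos j).2) \in sent by rewrite inE /= AU cA.
by have := eq_enc (exist (fun p => p \in sent) _ Ax); rewrite !ffunE.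
Qed.

End Scheme.

(** Count the sets avoiding [k] instead, and use that [K * 'C(K.-1, n)] equals
    [(K - n) * 'C(K, n)]. *)
Lemma sum_subsets_mem (K : nat) (k : 'I_K) (b : nat -> nat) :
  (K * \sum_(S : {set 'I_K} | k \in S) b #|S| = \sum_(n < K.+1) n * ('C(K, n) * b n))%N.
Proof.
have tot := sum_subsets [set: 'I_K]%SET b.
rewrite cardsT card_ord in tot.
rewrite (eq_bigl predT) in tot; last by move=> S; rewrite finset.subsetT.
have out := sum_subsets [set~ k]%SET b.
rewrite cardsC1 card_ord (eq_bigl (fun S : {set 'I_K} => k \notin S)) in out; last first.
  by move=> S; rewrite -finset.disjoints_subset disjoint_sym disjoints1.
rewrite (bigID (fun S : {set 'I_K} => k \in S)) /= out in tot.
apply: (@addIn (K * \sum_(n < K.+1) 'C(K.-1, n) * b n)%N).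
rewrite -mulnDr {}tot !big_distrr -big_split /=; apply: eq_bigr => n _.
rewrite [X in _ = (_ + X)%N]mulnA mul_bin_down.
by rewrite -mulnA -mulnDl subnKC // -ltnS.
Qed.

Lemma sum_subsets_meeting (R : realType) (K : nat) (U : {set 'I_K}) (b : nat -> nat) :
  (\sum_(A : {set 'I_K} | ~~ [disjoint A & U]) b #|A|.-1)%:R =
  \sum_(n < K.+1) (b n)%:R * ('C(K, n.+1)%:R - 'C(K - #|U|, n.+1)%:R) :> R.
Proof.
pose f n := if n is n'.+1 then b n' else 0%N.
have tot := sum_subsets [set: 'I_K]%SET f.
rewrite cardsT card_ord in tot.
rewrite (eq_bigl predT) in tot; last by move=> S; rewrite finset.subsetT.
have out := sum_subsets (~: U) f.
rewrite -(addKn #|U| #|~: U|) cardsC card_ord in out.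
rewrite (eq_bigl (fun S : {set 'I_K} => [disjoint S & U])) in out; last first.
  by move=> S; rewrite finset.disjoints_subset.
rewrite (bigID (fun S : {set 'I_K} => [disjoint S & U])) /= out in tot.
have -> : (\sum_(A : {set 'I_K} | ~~ [disjoint A & U]) b #|A|.-1)%N =
          (\sum_(A : {set 'I_K} | ~~ [disjoint A & U]) f #|A|)%N.
  apply: eq_bigr => A; have [->|[k kA] _] := set_0Vmem A.
    by rewrite -setI_eq0 finset.set0I eqxx.
  by rewrite (cardsD1 k A) kA.
move: tot => /(congr1 (fun n => n%:R : R)); rewrite natrD => /(canRL (addKr _)) ->.
rewrite !natr_sum addrC -sumrB big_ord_recl /= !muln0 subrr add0r.
rewrite [RHS]big_ord_recr /= bin_small // (@bin_small (K - #|U|)); last lia.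
rewrite subrr mulr0 addr0; apply: eq_bigr => n _.
by rewrite /bump /= !add1n !natrM; ring.
Qed.

(** * Upper bound for a fixed file size *)

Section UpperBound.
Variables (R : realType) (N K : nat).

Lemma Rformula_ge0 n : (n <= K)%N -> 0 <= Rformula R N K n.
Proof.
move=> nK; rewrite divr_ge0 // sumr_ge0 // => d _.
by rewrite rate_coeffE ?Ne_leq // sumr_ge0 // => i _; rewrite divr_ge0.
Qed.

Lemma has_lbound_rates (F : nat) (eps : R) (d : demand N K) (P : prefetching N K F) :
  has_lbound [set (L%:R / F%:R : R) | L in [set L | achievable_len eps d P L]]%classic.
Proof. by exists 0 => _ [L _ <-]; rewrite divr_ge0. Qed.

Lemma Rstar_eps_ge0 (F : nat) (eps : R) (P : prefetching N K F) :
  0 <= eps -> 0 <= Rstar_eps eps P.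
Proof.
move=> eps0; rewrite divr_ge0 // sumr_ge0 // => d _; apply: lb_le_inf.
  exists ((N * F)%:R / F%:R), (N * F)%N => //=; exact: achievable_len_uncoded.
by move=> _ [L _ <-]; rewrite divr_ge0.
Qed.

Lemma Rstar_eps_min_le (F : nat) (eps M : R) (b : nat -> nat) :
  (0 < F)%N -> 0 <= eps -> (\sum_(n < K.+1) 'C(K, n) * b n)%N = F ->
  (N * \sum_(n < K.+1) n * ('C(K, n) * b n))%:R <= K%:R * (M * F%:R) ->
  Rstar_eps_min N K F eps M <=
    \sum_(n < K.+1) ('C(K, n) * b n)%:R / F%:R * Rformula R N K n.
Proof.
move=> F0 eps0 b_sum b_mem.
have b_sum' : (\sum_(S : {set 'I_K}) b #|S|)%N = F.
  have := sum_subsets [set: 'I_K]%SET b; rewrite cardsT card_ord b_sum => <-.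
  by apply: eq_bigl => S; rewrite finset.subsetT.
have [pos pos_inj pos_codom] := ex_layout b_sum'.
apply: (@le_trans _ _ (Rstar_eps eps (placement N pos))).
  apply: ge_inf; first by exists 0 => _ [P _ <-]; exact: Rstar_eps_ge0.
  exists (placement N pos) => //= k.
  have K0 : (0 < K)%N by case: (K) k => [[]|].
  rewrite (card_placement N b_sum' k pos_inj pos_codom).
  rewrite -(ler_pM2l (_ : 0 < K%:R :> R)) ?ltr0n // -natrM.
  by rewrite mulnCA sum_subsets_mem.
rewrite /Rstar_eps /Rformula.
under [leRHS]eq_bigr do rewrite mulrA mulr_sumr.
rewrite -mulr_suml exchange_big /= ler_wpM2r ?invr_ge0 //.
apply: ler_sum => d _.
have [U cU ach] := placement_achievable b_sum' pos_inj pos_codom d eps0.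
apply: le_trans (ge_inf (has_lbound_rates eps d _) _) _.
  by exists (\sum_(A : {set 'I_K} | ~~ [disjoint A & U]) b #|A|.-1)%N.
rewrite sum_subsets_meeting cU mulr_suml; apply: ler_sum => n _.
rewrite le_eqVlt; apply/orP; left; apply/eqP; rewrite natrM; field.
by rewrite !pnatr_eq0 -!lt0n F0 bin_gt0 -ltnS ltn_ord.
Qed.

(** Rounding down loses at most ['C(K, i)] bits of each file for each size [i], hence at most
    [2 ^ K] in all; each costs the uncached rate [Rformula R N K 0]. *)
Lemma Rstar_eps_min_le_mix (F : nat) (eps M : R) (lam : 'I_K.+1 -> R) :
  (0 < N)%N -> (0 < F)%N -> 0 <= eps -> (forall i, 0 <= lam i) -> \sum_i lam i = 1 ->
  \sum_i lam i * (i : nat)%:R <= K%:R * M / N%:R ->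
  Rstar_eps_min N K F eps M <= \sum_i lam i * Rformula R N K i
    + (2 ^ K)%:R * Rformula R N K 0 / F%:R.
Proof.
move=> N0 F0 eps0 lam0 lam1 lamM.
have F0' : 0 < F%:R :> R by rewrite ltr0n.
have C0 (i : 'I_K.+1) : 0 < 'C(K, i)%:R :> R by rewrite ltr0n bin_gt0 -ltnS.
pose a (i : 'I_K.+1) := Num.truncn (lam i * F%:R / 'C(K, i)%:R).
have a_le (i : 'I_K.+1) : ('C(K, i) * a i)%:R <= lam i * F%:R.
  rewrite natrM mulrC -ler_pdivlMr // truncn_le.
  by rewrite !mulr_ge0 ?invr_ge0 // ltW.
have a_ge (i : 'I_K.+1) : lam i * F%:R <= ('C(K, i) * a i)%:R + 'C(K, i)%:R.
  have /truncn_itv/andP[_] : 0 <= lam i * F%:R / 'C(K, i)%:R.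
    by rewrite !mulr_ge0 ?invr_ge0 // ltW.
  rewrite ltr_pdivrMr // -/(a i) -natr1 mulrDl mul1r => /ltW.
  by rewrite natrM [_ * (a i)%:R]mulrC.
(* The bits lost by rounding down are left uncached. *)
pose rest := (\sum_(i < K) 'C(K, i.+1) * a (lift ord0 i))%N.
have rest_le : (rest <= F)%N.
  rewrite -(ler_nat R) natr_sum.
  apply: le_trans (_ : \sum_i lam i * F%:R <= _); last by rewrite -mulr_suml lam1 mul1r.
  rewrite big_ord_recl /= ler_wpDl ?mulr_ge0 //.
  by apply: ler_sum => i _; exact: (a_le (lift ord0 i)).
pose b n := if n is n'.+1 then a (inord n) else (F - rest)%N.
have bS (i : 'I_K) : b i.+1 = a (lift ord0 i).
  by rewrite /b; congr a; apply: val_inj; rewrite /= inordK // ltnS.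
have b0 : b 0%N = (F - rest)%N by [].
clearbody b.
have b_sum : (\sum_(n < K.+1) 'C(K, n) * b n)%N = F.
  rewrite big_ord_recl /= bin0 mul1n b0.
  by under eq_bigr do rewrite /bump /= add1n bS; rewrite subnK.
apply: le_trans (Rstar_eps_min_le F0 eps0 b_sum _) _.
  rewrite natrM natr_sum big_ord_recl /= mul0n add0r.
  have le : \sum_(i < K) (bump 0 i * ('C(K, bump 0 i) * b (bump 0 i)))%:R <=
      (\sum_i lam i * (i : nat)%:R) * F%:R :> R.
    rewrite mulr_suml [leRHS]big_ord_recl /= mulr0 mul0r add0r; apply: ler_sum => i _.
    rewrite /bump /= add1n bS natrM mulrAC mulrC ler_wpM2r //.
    exact: (a_le (lift ord0 i)).
  apply: le_trans (ler_wpM2l (ler0n R N) le) _.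
  rewrite ler_pdivlMr ?ltr0n // in lamM.
  by rewrite !mulrA ler_wpM2r // mulrC.
rewrite big_ord_recl [in leRHS]big_ord_recl /= bin0 mul1n b0 addrAC.
rewrite lerD //; last first.
  apply: ler_sum => i _; rewrite /bump /= add1n bS ler_wpM2r ?Rformula_ge0 //.
  by rewrite ler_pdivrMr //; exact: (a_le (lift ord0 i)).
rewrite [_%:R * Rformula _ _ _ _ / _]mulrAC -mulrDl ler_wpM2r ?Rformula_ge0 //.
rewrite ler_pdivrMr // mulrDl divfK ?gt_eqF //.
rewrite natrB // lerBlDr.
have {1}-> : F%:R = \sum_i lam i * F%:R :> R by rewrite -mulr_suml lam1 mul1r.
rewrite big_ord_recl /= -addrA lerD2l natr_sum.
have two : \sum_(i < K) 'C(K, i.+1)%:R <= (2 ^ K)%:R :> R.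
  rewrite -natr_sum ler_nat -[2%N]/(1 + 1)%N expnDn big_ord_recl /=.
  by apply: leq_trans (leq_addl _ _); apply: leq_sum => i _; rewrite !exp1n !muln1.
rewrite addrC; apply: le_trans (lerD (lexx _) two); rewrite -big_split /=.
by apply: ler_sum => i _; exact: (a_ge (lift ord0 i)).
Qed.
End UpperBound.

(** * Asymptotics *)

Lemma ler_addgt0_divn (R : archiRealFieldType) (x y C : R) (n0 : nat) :
  (forall n, (n0 <= n)%N -> (0 < n)%N -> x <= y + C / n%:R) -> x <= y.
Proof.
move=> le; apply/ler_addgt0Pr => e e0.
pose n := maxn n0 (Num.truncn (`|C| / e)).+1.
apply: le_trans (le n _ _) _; rewrite ?leq_maxl // ?leq_max ?orbT //.
rewrite lerD2l; apply: le_trans (ler_norm _) _.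
have n0' : 0 < n%:R :> R by rewrite ltr0n leq_max orbT.
rewrite normrM normfV (ger0_norm (ltW n0')) ler_pdivrMr // mulrC -ler_pdivrMr //.
apply/ltW/(lt_le_trans (truncnS_gt _)).
by rewrite ler_nat leq_maxr.
Qed.

Section LimSup.
Variables (R : realType) (u : nat -> R) (c C : R).
Hypotheses (C0 : 0 <= C) (u0 : forall n, 0 <= u n).
Hypothesis u_le : forall n, (0 < n)%N -> u n <= c + C / n%:R.

(** The hypothesis on [u] controls positive indices only, so [u 0] enters the bound separately. *)
Let u_bounded n : u n <= u 0%N + (c + C).
Proof.
case: n => [|n].
  have := u_le (ltn0Sn 0); have := u0 1; rewrite divr1; lra.
apply: le_trans (u_le _) _ => //; rewrite ler_wpDl // lerD2l.
by rewrite ler_pdivrMr ?ltr0n // ler_peMr // ler1n.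
Qed.

Let bounded_u : bounded_fun (u : nat -> R^o).
Proof.
exists (u 0%N + (c + C)); split; first exact: num_real.
by move=> x ltx n _; rewrite /= ger0_norm // (le_trans (u_bounded n)) // ltW.
Qed.

Lemma limn_sup_le : limn_sup u <= c.
Proof.
rewrite limn_supE //; apply: (@ler_addgt0_divn _ _ _ C 0) => n _ n0.
apply: (@le_trans _ _ (sups u n)).
  apply: ge_inf; first exact: bounded_fun_has_lbound_sups.
  by exists n.
apply: ge_sup; first by exists (u n), n => /=.
move=> _ [m /= nm <-]; have m0 := leq_trans n0 nm.
apply: le_trans (u_le m0) _; rewrite lerD2l ler_wpM2l //.
by rewrite lef_pV2 ?posrE ?ltr0n // ler_nat.
Qed.

Lemma limn_sup_ge a : (forall n, (0 < n)%N -> a - n%:R^-1 <= u n) -> a <= limn_sup u.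
Proof.
move=> u_ge; rewrite limn_supE //; apply: lb_le_inf; first by exists (sups u 0), 0%N.
move=> _ [n _ <-]; apply: (@ler_addgt0_divn _ _ _ 1 n) => m nm m0.
rewrite mul1r -lerBlDr; apply: le_trans (u_ge _ m0) _; apply: ub_le_sup.
  by exists (u 0%N + (c + C)) => _ [k _ <-]; exact: u_bounded.
by exists m.
Qed.
End LimSup.

Lemma Rformula_support_line (R : realType) (N K p : nat) : (p < K)%N ->
  exists s : R, [/\ s <= 0, Rformula R N K p.+1 = Rformula R N K p + s &
    forall n, (n <= K)%N ->
      Rformula R N K p + s * (n%:R - p%:R) <= Rformula R N K n].
Proof.
move=> pK; have [s s0 line] := rate_coeff_support_line R pK.
exists ((\sum_(d : {ffun 'I_K -> 'I_N}) s (Ne d)) / (N ^ K)%:R); split.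
- by rewrite mulr_le0_ge0 ?invr_ge0 // sumr_le0.
- rewrite /Rformula -mulrDl -big_split /=; congr (_ / _); apply: eq_bigr => d _.
  by have [] := line _ (Ne_leq d).
- move=> n nK; rewrite /Rformula mulrAC -mulrDl ler_wpM2r ?invr_ge0 //.
  rewrite mulr_suml -big_split /=; apply: ler_sum => d _.
  by have [_] := line _ (Ne_leq d); apply.
Qed.

(** * Bounds on the limiting rate *)

Section Rate.
Variables (R : realType) (N K : nat) (M : R).
Hypothesis M0 : 0 <= M.

Lemma Rstar_eps_min_ge0 F (eps : R) : 0 <= eps -> 0 <= Rstar_eps_min N.+1 K F eps M.
Proof.
move=> eps0; apply: lb_le_inf.
  pose P0 : prefetching N.+1 K F := [ffun=> finset.set0].
  exists (Rstar_eps eps P0), P0 => //= k.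
  by rewrite ffunE cards0 mulr_ge0.
by move=> _ [P _ <-]; exact: Rstar_eps_ge0.
Qed.

Definition mixture (lam : 'I_K.+1 -> R) (t : R) :=
  [/\ forall i, 0 <= lam i, \sum_i lam i = 1 & \sum_i lam i * (i : nat)%:R = t].

Lemma limn_sup_le_mix (eps t : R) (lam : 'I_K.+1 -> R) :
  0 <= eps -> mixture lam t -> t <= K%:R * M / N.+1%:R ->
  limn_sup (fun F => Rstar_eps_min N.+1 K F eps M) <= \sum_i lam i * Rformula R N.+1 K i.
Proof.
move=> eps0 [lam0 lam1 lamt] tM.
apply: (@limn_sup_le _ _ _ ((2 ^ K)%:R * Rformula R N.+1 K 0)).
- by rewrite mulr_ge0 ?Rformula_ge0.
- by move=> F; exact: Rstar_eps_min_ge0.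
- by move=> F F0; apply: Rstar_eps_min_le_mix => //; rewrite lamt.
Qed.

Lemma mixture_point (t : 'I_K.+1) : mixture (fun i => (i == t)%:R) (t : nat)%:R.
Proof.
split=> [i|| ]; first exact: ler0n.
  by rewrite (bigD1 t) //= eqxx big1 ?addr0 // => i /negPf->.
by rewrite (bigD1 t) //= eqxx mul1r big1 ?addr0 // => i /negPf->; rewrite mul0r.
Qed.

Lemma Rstar_le_mix (lam : 'I_K.+1 -> R) (t : R) :
  mixture lam t -> t <= K%:R * M / N.+1%:R ->
  Rstar N.+1 K M <= \sum_i lam i * Rformula R N.+1 K i.
Proof.
move=> mix tM; apply: ge_sup; first by eexists; exists 1 => //=; exact: ltr01.
by move=> _ [eps /= eps0 <-]; apply: limn_sup_le_mix mix tM; exact: ltW.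
Qed.

Lemma Rstar_ge_line (a s : R) : s <= 0 ->
  (forall n, (n <= K)%N -> a + s * n%:R <= Rformula R N.+1 K n) ->
  a + s * (K%:R * M / N.+1%:R) <= Rstar N.+1 K M.
Proof.
(* The largest [eps] that the converse allows; one value is enough below a supremum over [eps]. *)
move=> s0 line; pose eps : R := ((2 * K.+1)%:R)^-1.
have eps0 : 0 < eps by rewrite invr_gt0 ltr0n.
have t0 : 0 <= K%:R * M / N.+1%:R by rewrite divr_ge0 ?mulr_ge0.
have mix0 := mixture_point ord0.
apply: (@le_trans _ _ (limn_sup (fun F => Rstar_eps_min N.+1 K F eps M))).
  apply: (@limn_sup_ge _ _ _ ((2 ^ K)%:R * Rformula R N.+1 K 0)).
  - by rewrite mulr_ge0 ?Rformula_ge0.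
  - by move=> F; apply: Rstar_eps_min_ge0; exact: ltW.
  - move=> F F0; case: mix0 => lam0 lam1 lamt.
    by apply: (Rstar_eps_min_le_mix _ F0 (ltW eps0) lam0 lam1); rewrite ?lamt.
  - move=> F F0; apply: Rstar_eps_min_ge => //; first exact: ltW.
    by rewrite mulVf // pnatr_eq0.
apply: ub_le_sup; last by exists eps.
(* The scheme without caching bounds the limit for every [eps], so the supremum is over a bounded
   set. *)
exists (\sum_i (i == ord0 :> 'I_K.+1)%:R * Rformula R N.+1 K i).
by move=> _ [e /= e0 <-]; apply: limn_sup_le_mix mix0 _ => //; exact: ltW.
Qed.

End Rate.

Lemma Rstar_int (R : realType) (N K : nat) (M : R) (t : nat) : 0 <= M ->
  (t <= K)%N -> K%:R * M / N.+1%:R = t%:R -> Rstar N.+1 K M = Rformula R N.+1 K t.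
Proof.
move=> M0 tK tE; apply/eqP; rewrite eq_le; apply/andP; split.
  apply: le_trans (Rstar_le_mix M0 (mixture_point R (inord t)) _) _.
    by rewrite inordK ?ltnS // tE.
  rewrite (bigD1 (inord t)) //= eqxx mul1r big1 ?addr0 ?inordK //.
  by move=> i /negPf->; rewrite mul0r.
(* A support line at [t]: the chord over [t] and [t.+1], or, when [t = K], the chord over the last
   two points, or a constant when [K = 0]. *)
have [a [s [s0 at_t line]]] : exists a s : R, [/\ s <= 0,
    a + s * t%:R = Rformula R N.+1 K t &
    forall n, (n <= K)%N -> a + s * n%:R <= Rformula R N.+1 K n].
  have shift p n (s : R) : Rformula R N.+1 K p - s * p%:R + s * n%:R =
      Rformula R N.+1 K p + s * (n%:R - p%:R) by ring.
  move: tK; rewrite leq_eqVlt => /orP[/eqP tK|tK].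
    case: K => [|p] in tK tE shift *.
      exists (Rformula R N.+1 0 0), 0; rewrite tK mul0r addr0; split=> // n.
      by rewrite leqn0 => /eqP->; rewrite mul0r addr0.
    have [s [s0 next line]] := Rformula_support_line R N.+1 (ltnSn p).
    exists (Rformula R N.+1 p.+1 p - s * p%:R), s; split=> //.
      by rewrite tK next -natr1; ring.
    by move=> n nK; rewrite shift line.
  have [s [s0 _ line]] := Rformula_support_line R N.+1 tK.
  exists (Rformula R N.+1 K t - s * t%:R), s; split=> //; first by rewrite subrK.
  by move=> n nK; rewrite shift line.
by rewrite -at_t -tE; exact: Rstar_ge_line.
Qed.

Lemma mixture_interpolation (R : realType) (K p : nat) (t : R) (r : nat -> R) :
  (p < K)%N -> p%:R <= t -> t <= p.+1%:R ->
  exists2 lam : 'I_K.+1 -> R, mixture lam t &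
    \sum_i lam i * r i = r p + (r p.+1 - r p) * (t - p%:R).
Proof.
move=> pK pt tp.
pose i0 : 'I_K.+1 := inord p; pose i1 : 'I_K.+1 := inord p.+1.
have i0E : i0 = p :> nat by rewrite inordK // ltnS ltnW.
have i1E : i1 = p.+1 :> nat by rewrite inordK.
pose lam i := (i == i0)%:R * (p.+1%:R - t) + (i == i1)%:R * (t - p%:R) : R.
have sum_lam g : \sum_i lam i * g i = (p.+1%:R - t) * g i0 + (t - p%:R) * g i1.
  have pick j x : \sum_(i < K.+1) ((i == j)%:R * x) * g i = x * g j.
    rewrite (bigD1 j) //= eqxx mul1r big1 ?addr0 // => i /negPf->.
    by rewrite !mul0r.
  by under eq_bigr do rewrite mulrDl; rewrite big_split /= !pick.
exists lam; last by rewrite (sum_lam (fun i => r i)) i0E i1E -natr1; ring.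
split.
- by move=> i; rewrite addr_ge0 // mulr_ge0 // subr_ge0.
- by under eq_bigr do rewrite -[lam _]mulr1; rewrite (sum_lam (fun=> 1)) -natr1; ring.
- by rewrite (sum_lam (fun i => (i : nat)%:R)) i0E i1E -natr1; ring.
Qed.

Local Open Scope classical_set_scope.

Theorem theorem1 (R : realType) (N K : nat) (hN : (0 < N)%N) :
  (forall (M : R) (t : nat), 0 <= M <= N%:R -> (t <= K)%N ->
     K%:R * M / N%:R = t%:R -> Rstar N K M = Rformula R N K t) /\
  (forall M : R, 0 <= M <= N%:R ->
     (forall t : nat, K%:R * M / N%:R != t%:R) ->
     Rstar N K M =
       lower_convex_envelope K
         (fun i : nat => Rstar N K (i%:R * N%:R / K%:R))
         (K%:R * M / N%:R)).
Proof.
case: N hN => // N _; split=> [M t /andP[M0 _]|M /andP[M0 MN] nint].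
  exact: Rstar_int.
have [K0|K0] := posnP K; first by have := nint 0%N; rewrite K0 !mul0r eqxx.
have K0' : 0 < K%:R :> R by rewrite ltr0n.
set t := K%:R * M / N.+1%:R.
have t0 : 0 <= t by rewrite divr_ge0 ?mulr_ge0.
have tK : t < K%:R.
  rewrite lt_neqAle nint /= ler_pdivrMr ?ltr0n //.
  by rewrite ler_wpM2l.
have /andP[pt tp] := truncn_itv t0; set p := Num.truncn t in pt tp.
have pK : (p < K)%N by rewrite -(ltr_nat R) (le_lt_trans pt).
have [s [s0 next line]] := Rformula_support_line R N.+1 pK.
(* By the integer case, the envelope is that of [Rformula]. *)
have envE (lam : 'I_K.+1 -> R) :
    \sum_(i < K.+1) lam i * Rstar N.+1 K (i%:R * N.+1%:R / K%:R) =
    \sum_(i < K.+1) lam i * Rformula R N.+1 K i.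
  apply: eq_bigr => i _; congr (_ * _); apply: Rstar_int.
  - by rewrite divr_ge0 ?mulr_ge0.
  - by rewrite -ltnS.
  - by field; rewrite nat1r ?gt_eqF //.
have [lam mix lamE] := mixture_interpolation (Rformula R N.+1 K) pK pt (ltW tp).
apply/eqP; rewrite eq_le; apply/andP; split.
  apply: lb_le_inf; first by eexists; exists lam => //; exact: mix.
  by move=> _ [lam' /= mix' <-]; rewrite envE; exact: Rstar_le_mix mix' _.
(* The envelope is at most the interpolation between [p] and [p.+1]. This value lies on the chord
   there, which is a support line and so bounds [Rstar] from below. *)
apply: (@le_trans _ _ (\sum_(i < K.+1) lam i * Rformula R N.+1 K i)).
  apply: ge_inf; last by exists lam => //; rewrite envE.
  exists (Rstar N.+1 K M) => _ [lam' /= mix' <-].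
  by rewrite envE; exact: Rstar_le_mix mix' _.
rewrite lamE next [_ + s]addrC addrK.
have -> : Rformula R N.+1 K p + s * (t - p%:R) =
  Rformula R N.+1 K p - s * p%:R + s * t by ring.
apply: Rstar_ge_line => // n nK; apply: le_trans (line n nK).
by rewrite le_eqVlt; apply/orP; left; apply/eqP; ring.
Qed.
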